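(* Let $m \geq 1$ and $k \geq 2$ be integers and let $A \simeq \mathbb{Z}^m$ be a free abelian group with basis $a_1,\dots,a_m$. Then the asymptotic density $\rho(SAT(A,k)) = \lim_{r\to\infty}\rho_r(SAT(A,k))$ of the set of equations in $k$ variables over $A$ that are satisfiable in $A$ exists, and $$\rho(SAT(A,k)) = \frac{\zeta(k+m)}{\zeta(k)}.$$
   Context: The space of equations in variables $X=\{x_1,\dots,x_k\}$ over $A$ is the free abelian group $A_X = A(x_1,\dots,x_k)\times A(a_1,\dots,a_m)$ with basis $x_1,\dots,x_k,a_1,\dots,a_m$ (written multiplicatively). Each $w\in A_X$ is uniquely $w = x_1^{\gamma_1}\cdots x_k^{\gamma_k}a_1^{\alpha_1}\cdots a_m^{\alpha_m}$ with $\gamma_i,\alpha_j\in\mathbb{Z}$. The norm is $\|w\|=\max\{|\gamma_1|,\dots,|\gamma_k|,|\alpha_1|,\dots,|\alpha_m|\}$, and $B_r=\{w\in A_X : \|w\|\le r\}$. $SAT(A,k)\subseteq A_X$ is the set of all $w\in A_X$ such that the equation $w=1$ has a solution in $A$, i.e. there are $h_1,\dots,h_k\in A$ with $h_1^{\gamma_1}\cdots h_k^{\gamma_k}a_1^{\alpha_1}\cdots a_m^{\alpha_m}=1$. For $S\subseteq A_X$, $\rho_r(S)=|S\cap B_r|/|B_r|$ and $\rho(S)=\lim_{r\to\infty}\rho_r(S)$ when the limit exists. $\zeta$ is the Riemann zeta function, $\zeta(t)=\sum_{n\ge1} n^{-t}$. *)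

(* Defs.v *)
From mathcomp Require Import all_boot all_order all_algebra finmap zify.
From mathcomp Require Import all_classical all_reals all_analysis.
Set Implicit Arguments.
Unset Strict Implicit.
Unset Printing Implicit Defensive.
Import Order.TTheory GRing.Theory Num.Theory.
Import numFieldNormedType.Exports.
Local Open Scope classical_set_scope.
Local Open Scope ring_scope.

(* Abelian groups are [zmodType]s and hence written additively: the product
   h_1^{c_1} ... h_n^{c_n} is [\sum_i h i *~ c 0 i] and 1 is [0]. *)

Definition is_basis (A : zmodType) (m : nat) (a : 'I_m -> A) : Prop :=
  forall x : A, exists! c : 'rV[int]_m, x = \sum_j a j *~ c 0 j.

(* The free abelian group on x_1, ..., x_k, a_1, ..., a_m: a pair (c, d) is the
   element x_1^{c_1} ... x_k^{c_k} a_1^{d_1} ... a_m^{d_m}. *)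
Notation equations k m := ('rV[int]_k * 'rV[int]_m)%type.

Definition eqn_norm (k m : nat) (w : equations k m) : nat :=
  maxn (\max_(i < k) `|w.1 0%R i|%N) (\max_(j < m) `|w.2 0%R j|%N).

Definition eqn_ball (k m r : nat) : set (equations k m) :=
  [set w | (eqn_norm w <= r)%N].
Arguments eqn_ball : clear implicits.

Definition SAT (A : zmodType) (k m : nat) (a : 'I_m -> A) :
    set (equations k m) :=
  [set w : equations k m | exists h : 'I_k -> A,
     (\sum_i h i *~ w.1 0 i) + (\sum_j a j *~ w.2 0 j) = 0].
Arguments SAT {A} k {m} a.

(* [fset_set] sends infinite sets to the empty one, so this is needed for the
   cardinals in [rho_] to be the intended ones. *)
Lemma finite_eqn_ball (k m r : nat) : finite_set (eqn_ball k m r).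
Proof.
pose T : finType := ({ffun 'I_k -> 'I_(r + r).+1} *
                     {ffun 'I_m -> 'I_(r + r).+1})%type.
pose f (t : T) : equations k m :=
  (\row_i ((t.1 i : nat)%:Z - r%:Z), \row_j ((t.2 j : nat)%:Z - r%:Z)).
apply: (@sub_finite_set _ _ (f @` [set: T])); last first.
  by apply: finite_image; exact: finite_finset.
move=> [c d]; rewrite /eqn_ball /eqn_norm /= geq_max.
move=> /andP[/bigmax_leqP hc /bigmax_leqP hd].
exists ([ffun i => inord (absz (c 0 i + r%:Z))],
        [ffun j => inord (absz (d 0 j + r%:Z))]) => //.
congr pair; apply/rowP => i; rewrite !mxE /= ?ord1 ffunE inordK.
- by move: (hc i isT); lia.
- by move: (hc i isT); lia.
- by move: (hd i isT); lia.
- by move: (hd i isT); lia.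
Qed.

Definition rho_ (R : realType) (k m : nat) (S : set (equations k m)) :
    R ^nat :=
  fun r => #|` fset_set (S `&` eqn_ball k m r)|%:R /
           #|` fset_set (eqn_ball k m r)|%:R.

(* Meaningful only when [rho_ R S] converges. *)
Definition rho (R : realType) (k m : nat) (S : set (equations k m)) : R :=
  limn (rho_ R S).

(* Meaningful for 1 < t, where the series converges. *)
Definition zeta (R : realType) (t : R) : R := limn (series (riemannR t)).

(* Main.v *)
(** An equation [c.x + d.a = 0] is satisfiable iff [gcd c] divides every entry
    of [d]. Let [P n] be the number of vectors of gcd 1 in the box [-n, n]^k.
    Sorting the satisfiable equations of norm at most [r] by [g = gcd c] gives
    [1 + \sum_(1 <= g <= r) P (r %/ g) * (2 (r %/ g) + 1)^m] of them, and the case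
    [m = 0] reads [(2r+1)^k = 1 + \sum_(1 <= g <= r) P (r %/ g)].
    Since [(2 (r %/ g) + 1) / (2r+1)] tends to [1/g] and is at most [2/g], dominated
    convergence turns a limit [p] of [P n / (2n+1)^k] into the density
    [p * zeta (k + m)]. The case [m = 0] then shows that [P n / (2n+1)^k - 1 / zeta k]
    has dilation sums tending to 0, which forces it to tend to 0 because
    [zeta k < 2]; no Moebius inversion is needed. *)
Require Import Defs.
From mathcomp Require Import all_boot all_order all_algebra finmap zify ring lra.
From mathcomp Require Import all_classical all_reals all_analysis.
Import Order.TTheory GRing.Theory Num.Theory.
Import numFieldNormedType.Exports.
Local Open Scope classical_set_scope.
Local Open Scope ring_scope.

(** * Dominated convergence for sums whose length grows *)

(** Tannery's theorem: the first [N] terms converge as a finite sum, and the remaining ones are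
    bounded by a tail of the series of [b]. Domination is asked only for [d < n], the range of the
    sum; [side_ratio_le] provides no more. *)
Lemma series_dominated_cvg (R : realType) (f : nat -> R ^nat) (g b : R ^nat) :
  (forall d, f ^~ d @ \oo --> g d) ->
  (forall n d, (d < n)%N -> `|f n d| <= b d) ->
  cvgn (series b) -> cvgn (series g) ->
  \sum_(0 <= d < n) f n d @[n --> \oo] --> limn (series g).
Proof.
move=> fg fb cb cg; apply/cvgrPdist_le => e e0.
(* Four errors add up: the tail of [g], the first [N] terms, and the distances of two partial sums
   of [b] (at [N] and at [n]) from their limit. *)
have e4 : 0 < e / 4%:R by rewrite divr_gt0.
have /cvgrPdist_le/(_ _ e4)[N1 _ hN1] := cb.
have /cvgrPdist_le/(_ _ e4)[N2 _ hN2] := cg.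
pose N := maxn N1 N2.
have fN : \sum_(0 <= d < N) f n d @[n --> \oo] --> series g N.
  by apply: (cvg_big add_continuous) => d _; exact: fg.
have {fN} /cvgrPdist_le/(_ _ e4) [N3 _ hN3] := fN.
exists (maxn N N3) => // n /=; rewrite geq_max => /andP[Nn N3n].
have -> : limn (series g) - \sum_(0 <= d < n) f n d =
    (limn (series g) - series g N) + (series g N - \sum_(0 <= d < N) f n d)
    - \sum_(N <= d < n) f n d.
  by rewrite [in LHS](big_cat_nat (leq0n N) Nn) //= opprD !addrA subrK.
have h1 : `|limn (series g) - series g N| <= e / 4%:R.
  by apply: hN2; rewrite /= leq_max leqnn orbT.
have h2 : `|series g N - \sum_(0 <= d < N) f n d| <= e / 4%:R by exact: hN3.
have h3 : `|\sum_(N <= d < n) f n d| <= series b n - series b N.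
  rewrite sub_series_geq //; apply: le_trans (ler_norm_sum _ _ _) _.
  by rewrite big_nat [leRHS]big_nat; apply: ler_sum => d /andP[_ dn]; exact: fb.
have h4 : `|limn (series b) - series b n| <= e / 4%:R.
  by apply: hN1 => /=; rewrite (leq_trans _ Nn) // leq_max leqnn.
have h5 : `|limn (series b) - series b N| <= e / 4%:R.
  by apply: hN1; rewrite /= leq_max leqnn.
move: h1 h2 h4 h5; rewrite !ler_norml => /andP[? ?] /andP[? ?] /andP[? ?] /andP[? ?].
by move: h3; rewrite ler_norml => /andP[? ?]; apply/andP; split; lra.
Qed.

(** * Bounds on zeta at integers greater than 1 *)

Definition inv_pow (R : realType) (K : nat) : R ^nat := fun d => (d.+1%:R ^+ K)^-1.

Lemma zetaE (R : realType) (K : nat) : zeta (K%:R : R) = limn (series (inv_pow R K)).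
Proof.
rewrite /zeta; congr (limn (series _)); apply/funext => d.
by rewrite /riemannR /inv_pow powR_mulrn.
Qed.

Lemma inv_pow_ge0 (R : realType) (K d : nat) : 0 <= inv_pow R K d.
Proof. by rewrite invr_ge0 exprn_ge0. Qed.

(** The case [K = 2] dominates, and there 1/(x+1)^2 <= 1/x - 1/(x+1) telescopes. Telescoping from
    the second term on gives 1 + 1/4 + 1/2 = 7/4; from the first it would give 2, too weak for the
    contraction in [dilation_sum_cvg0]. *)
Lemma series_inv_pow_le (R : realType) (K n : nat) : (1 < K)%N ->
  series (inv_pow R K) n <= 7%:R / 4%:R.
Proof.
move=> K1.
have mono d : inv_pow R K d <= inv_pow R 2 d.
  rewrite lef_pV2 ?posrE ?exprn_gt0 //.
  by apply: ler_weXn2l => //; rewrite ler1n.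
have bnd p : series (inv_pow R 2) p.+2 <= 7%:R / 4%:R - p.+2%:R^-1.
  elim: p => [|p ih]; first by rewrite /series /inv_pow /= !big_nat_recr //= big_geq //; lra.
  rewrite /series /= big_nat_recr //=; apply: le_trans (lerD ih (lexx _)) _.
  rewrite /inv_pow -addrA lerD2l -[p.+3%:R]natr1.
  set x : R := p.+2%:R; have x0 : 0 < x by rewrite ltr0n.
  rewrite -subr_ge0.
  have -> : - (x + 1)^-1 - (- x^-1 + ((x + 1) ^+ 2)^-1) = (x * (x + 1) ^+ 2)^-1.
    by field; rewrite !lt0r_neq0 // addr_gt0.
  by rewrite invr_ge0 mulr_ge0 ?exprn_ge0 ?addr_ge0 // ltW.
(* Two extra terms bring every length, 0 and 1 included, within reach of [bnd]. *)
have le2 p : series (inv_pow R 2) p <= series (inv_pow R 2) p.+2.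
  rewrite /series /= !big_nat_recr //= -addrA lerDl addr_ge0 //; exact: inv_pow_ge0.
apply: (@le_trans _ _ (series (inv_pow R 2) n)); first by apply: ler_sum => d _; exact: mono.
apply: le_trans (le2 _) (le_trans (bnd _) _).
by rewrite gerBl invr_ge0.
Qed.

Lemma is_cvg_series_inv_pow (R : realType) (K : nat) : (1 < K)%N ->
  cvgn (series (inv_pow R K)).
Proof.
move=> K1; apply: nondecreasing_is_cvgn.
  by apply: nondecreasing_series => n _ _; exact: inv_pow_ge0.
by exists (7%:R / 4%:R) => _ [n _ <-]; exact: series_inv_pow_le.
Qed.

Lemma zeta_le (R : realType) (K : nat) : (1 < K)%N -> zeta (K%:R : R) <= 7%:R / 4%:R.
Proof.
move=> K1; rewrite zetaE; apply: limr_le; first exact: is_cvg_series_inv_pow.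
by apply: nearW => n; exact: series_inv_pow_le.
Qed.

Lemma zeta_ge1 (R : realType) (K : nat) : (1 < K)%N -> 1 <= zeta (K%:R : R).
Proof.
move=> K1; rewrite zetaE; apply: limr_ge; first exact: is_cvg_series_inv_pow.
exists 1%N => // -[//|n] _; rewrite /series /= big_nat_recl //= /inv_pow expr1n invr1.
by rewrite lerDl sumr_ge0 // => i _; exact: (inv_pow_ge0 R K i.+1).
Qed.

(** * Dilation sums and their limits *)

(** Ratio of the numbers of integers in [-q, q] and [-n, n], where q is the quotient of [n] by
    [d.+1]. The index [d] stands for the gcd [d.+1]. *)
Definition side_ratio (R : realType) (n d : nat) : R :=
  (n %/ d.+1).*2.+1%:R / n.*2.+1%:R.

Lemma side_ratio_ge0 (R : realType) (n d : nat) : 0 <= side_ratio R n d.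
Proof. by rewrite divr_ge0. Qed.

Lemma side_ratio_cvg (R : realType) (d : nat) :
  side_ratio R n d @[n --> \oo] --> (d.+1%:R^-1 : R).
Proof.
have h n : `|side_ratio R n d - d.+1%:R^-1| <= harmonic n.
  rewrite /side_ratio /harmonic /=.
  have := divn_eq n d.+1; set q := (n %/ d.+1)%N; set s := (n %% d.+1)%N => nE.
  have sd : (s < d.+1)%N by rewrite ltn_mod.
  have dn : (d.+1%:R : R) != 0 by rewrite pnatr_eq0.
  have n0 : (n.*2.+1%:R : R) != 0 by rewrite pnatr_eq0.
  (* Writing n = q (d+1) + s cancels the terms in q; since 0 <= s <= d, the numerator d - 2s is at
     most d + 1 in absolute value. *)
  have -> : q.*2.+1%:R / n.*2.+1%:R - d.+1%:R^-1 =
      ((d%:R - s%:R *+ 2) / d.+1%:R) / n.*2.+1%:R :> R.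
    have nR : n.*2.+1%:R = 2%:R * q%:R * (d%:R + 1) + 2%:R * s%:R + 1 :> R.
      by rewrite {1}nE -muln2 -natr1 natrM natrD natrM -natr1; ring.
    have qR : q.*2.+1%:R = 2%:R * q%:R + 1 :> R by rewrite -muln2 -natr1 natrM mulrC.
    have dR : d.+1%:R = d%:R + 1 :> R by rewrite -natr1.
    move: n0 dn; rewrite nR qR dR => n0 dn.
    by field; apply/andP; split.
  rewrite normrM normfV (ger0_norm (ler0n _ _)).
  rewrite -[leRHS]mul1r; apply: ler_pM => //.
    rewrite normrM normfV (ger0_norm (ler0n _ _)) ler_pdivrMr // mul1r.
    rewrite ler_norml -natr1; have : (s%:R : R) <= d%:R by rewrite ler_nat -ltnS.
    have : 0 <= s%:R :> R by []. rewrite -mulr_natr.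
    by move=> ? ?; apply/andP; split; lra.
  by rewrite lef_pV2 ?posrE // ler_nat; lia.
apply/cvgrPdist_le => e e0.
have /cvgrPdist_le/(_ _ e0)[N _ hN] := @cvg_harmonic R.
exists N => // n /hN; rewrite sub0r normrN => hn; rewrite distrC.
by apply: le_trans (h n) (le_trans (ler_norm _) hn).
Qed.

Lemma side_ratio_le (R : realType) (n d : nat) : (d < n)%N ->
  side_ratio R n d <= 2%:R / d.+1%:R.
Proof.
move=> dn; rewrite /side_ratio ler_pdivrMr // mulrAC ler_pdivlMr // -!natrM ler_nat.
have := leq_trunc_div n d.+1; have : (0 < n %/ d.+1)%N by rewrite divn_gt0.
by set q := (n %/ d.+1)%N => ? ?; nia.
Qed.

Lemma cvg_divn_infty (d : nat) : (n %/ d.+1)%N @[n --> \oo] --> \oo.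
Proof.
apply/cvgnyPge => B; exists (B * d.+1)%N => // n /=.
by rewrite leq_divRL.
Qed.

(** Term [d] tends to [L] / (d+1)^K because [n %/ d.+1] tends to infinity, and it is at most [B] 2^K
    / (d+1)^K, which is summable for [K > 1]. *)
Lemma dilation_sum_cvg (R : realType) (K : nat) (x : R ^nat) (L B : R) :
  (1 < K)%N -> x @ \oo --> L -> (forall n, `|x n| <= B) ->
  \sum_(0 <= d < n) x (n %/ d.+1)%N * side_ratio R n d ^+ K @[n --> \oo]
    --> L * zeta (K%:R : R).
Proof.
move=> K1 xL xB; have cK := @is_cvg_series_inv_pow R K K1.
have scaleE (c : R) : series (fun d => c * inv_pow R K d) = fun n => c * series (inv_pow R K) n.
  by apply/funext => n; rewrite /series /= -mulr_sumr.
have cc (c : R) : series (fun d => c * inv_pow R K d) @ \oo --> c * zeta (K%:R : R).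
  by rewrite scaleE zetaE; apply: cvgMr.
rewrite -(cvg_lim (@norm_hausdorff _ _) (cc L)).
apply: (@series_dominated_cvg _ _ _ (fun d => B * 2%:R ^+ K * inv_pow R K d)).
- move=> d; apply: cvgM; first exact: (cvg_comp _ _ (@cvg_divn_infty d) xL).
  rewrite /inv_pow -exprVn; exact: (cvg_comp _ _ (@side_ratio_cvg R d) (@exprn_continuous R K _)).
- move=> n d dn; rewrite normrM -mulrA ler_pM // normrX ger0_norm ?side_ratio_ge0 //.
  by rewrite /inv_pow -exprVn -exprMn lerXn2r ?nnegrE ?side_ratio_ge0 ?divr_ge0 ?side_ratio_le.
- exact/cvgP/cc.
- exact/cvgP/cc.
Qed.

(* If [|x|] is eventually at most [M], isolating the term [d = 0] of the sum
   shows that it is eventually at most [(zeta K - 1) M + o(1)], and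
   [zeta K - 1 <= 3/4]: iterating gives [x --> 0]. *)
Lemma dilation_sum_cvg0 (R : realType) (K : nat) (x : R ^nat) (B : R) :
  (1 < K)%N -> (forall n, `|x n| <= B) ->
  \sum_(0 <= d < n) x (n %/ d.+1)%N * side_ratio R n d ^+ K @[n --> \oo] --> 0 ->
  x @ \oo --> 0.
Proof.
move=> K1 xB sx.
have ratio0 n : side_ratio R n 0 = 1 by rewrite /side_ratio divn1 divff.
have contract (M : R) : 0 < M -> (\forall n \near \oo, `|x n| <= M) ->
    \forall n \near \oo, `|x n| <= (7%:R / 8%:R) * M.
  move=> M0 [N _ hN].
  (* The sum also evaluates [x] at small quotients, where the bound [M] may fail. The majorant [y]
     of [|x|] keeps the true values there and is constant from [N] on, so its dilation sum tends to
     [M * zeta K]. *)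
  pose y n := if (n < N)%N then `|x n| else M.
  have xy n : `|x n| <= y n by rewrite /y; case: ltnP => // /hN.
  have yM : y @ \oo --> M.
    apply: cvg_near_cst; exists N => // n /= Nn.
    by rewrite /y ltnNge Nn.
  have yB n : `|y n| <= `|B| + M.
    have B0 : 0 <= B by apply: le_trans (xB 0%N).
    rewrite /y; case: ltnP => _; last by rewrite (gtr0_norm M0) lerDr.
    by rewrite normr_id (le_trans (xB n)) // (ger0_norm B0) lerDl ltW.
  have sy := @dilation_sum_cvg R K y M _ K1 yM yB.
  (* The two errors leave [|x n|] at most M (3/4 + 1/32 + 1/32), which is below 7/8 M. *)
  have e0 : 0 < M / 32%:R by rewrite divr_gt0.
  have /cvgrPdist_le/(_ _ e0)[N1 _ h1] := sx.
  have /cvgrPdist_le/(_ _ e0)[N2 _ h2] := sy.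
  exists (maxn N.+1 (maxn N1 N2)) => // n /=.
  rewrite !geq_max => /andP[Nn /andP[/h1 {}h1 /h2 {}h2]].
  have n0 : (0 < n)%N by apply: leq_trans Nn.
  move: h1 h2; rewrite sub0r normrN.
  rewrite !(big_ltn n0) !ratio0 expr1n !mulr1 divn1.
  set S := \sum_(_ <= _ < _) _; set T := \sum_(_ <= _ < _) _ => h1 h2.
  have ST : `|S| <= T.
    apply: le_trans (ler_norm_sum _ _ _) _; apply: ler_sum => d _.
    rewrite normrM normrX (ger0_norm (side_ratio_ge0 _ _ _)) ler_wpM2r //.
    by rewrite exprn_ge0 // side_ratio_ge0.
  have yn : y n = M by rewrite /y ltnNge ltnW.
  have zM : M * zeta (K%:R : R) <= M * (7%:R / 4%:R).
    by rewrite ler_wpM2l ?zeta_le // ltW.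
  have xS : `|x n| <= `|x n + S| + `|S|.
    by rewrite -{1}[x n](addrK S); exact: ler_normB.
  move: h2; rewrite yn ler_norml => /andP[h2 _].
  by lra.
have B1 : 0 < `|B| + 1 by rewrite ltr_wpDl.
have iter_contract j : \forall n \near \oo, `|x n| <= (`|B| + 1) * (7%:R / 8%:R) ^+ j.
  elim: j => [|j ih].
    apply: nearW => n; rewrite expr0 mulr1; apply: le_trans (xB n) _.
    by apply: le_trans (ler_norm _) _; rewrite lerDl.
  rewrite exprS mulrCA; apply: contract ih.
  by rewrite mulr_gt0 // exprn_gt0 // divr_gt0.
apply/cvgrPdist_le => e e0.
have geo : geometric (`|B| + 1) (7%:R / 8%:R : R) @ \oo --> 0.
  by apply: cvg_geometric; rewrite ger0_norm; lra.
have /cvgrPdist_le/(_ _ e0)[j _ /(_ j (leqnn _))] := geo.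
rewrite sub0r normrN /= => hj.
have [N _ hN] := iter_contract j; exists N => // n /hN hn.
by rewrite sub0r normrN; apply: le_trans hn (le_trans (ler_norm _) hj).
Qed.

(** * Integer boxes, their cardinals, and gcds of vectors *)

Definition box (k r : nat) : set 'rV[int]_k := [set v | forall i, (`|v 0%R i| <= r)%N].

(** Parametrizes the box by matrices over a finite type, whose number is known. *)
Definition unbias {k r : nat} (t : 'rV['I_r.*2.+1]_k) : 'rV[int]_k :=
  map_mx (fun x : 'I_r.*2.+1 => (x : nat)%:Z - r%:Z) t.

Lemma unbias_inj (k r : nat) : injective (@unbias k r).
Proof.
move=> t u /rowP tu; apply/rowP => i; have := tu i; rewrite !mxE => tui.
by apply: val_inj => /=; lia.
Qed.

Lemma boxE (k r : nat) : box k r = @unbias k r @` [set` [fset t in 'rV['I_r.*2.+1]_k]%fset].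
Proof.
apply/seteqP; split => [v vr|_ [t _ <-] i]; last first.
  by rewrite mxE; case: (t 0 i) => x /= xr; lia.
exists (\row_i inord (absz (v 0 i + r%:Z))); first by rewrite /= inE.
apply/rowP => i; rewrite !mxE inordK; by have := vr i; lia.
Qed.

Lemma finite_box (k r : nat) : finite_set (box k r).
Proof. by rewrite boxE; apply: finite_image; exact: finite_fset. Qed.

Lemma card_image_inj {T U : choiceType} {f : T -> U} {X : set T} :
  injective f -> finite_set X -> #|` fset_set (f @` X)| = #|` fset_set X|.
Proof. by move=> fI fX; rewrite fset_set_image // card_imfset. Qed.

Lemma card_box (k r : nat) : #|` fset_set (box k r)| = (r.*2.+1 ^ k)%N.
Proof.
rewrite boxE card_image_inj; [|exact: unbias_inj|exact: finite_fset].
by rewrite set_fsetK card_finset card_mx card_ord mul1n.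
Qed.

Lemma card_setX (T U : choiceType) (X : set T) (Y : set U) :
  finite_set X -> finite_set Y ->
  #|` fset_set (X `*` Y)| = (#|` fset_set X| * #|` fset_set Y|)%N.
Proof.
move=> fX fY; rewrite fset_setX //.
rewrite -(size_allpairs pair) /=; apply/perm_size/uniq_perm; first exact: fset_uniq.
  by apply: allpairs_uniq; rewrite ?fset_uniq // => -[x y] [z t].
move=> [x y]; rewrite in_fsetM /=; apply/andP/allpairsP => [[? ?]|[[z t] [? ? [-> ->]]]] //.
by exists (x, y).
Qed.

Lemma eqn_ballE (k m r : nat) : eqn_ball k m r = box k r `*` box m r.
Proof.
apply/seteqP; split => -[c d]; rewrite /eqn_ball /eqn_norm /= geq_max.
  by move=> /andP[/bigmax_leqP hc /bigmax_leqP hd]; split => i; [exact: hc|exact: hd].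
by move=> [hc hd]; apply/andP; split; apply/bigmax_leqP => i _; [exact: hc|exact: hd].
Qed.

Definition vgcd {k : nat} (v : 'rV[int]_k) : nat := (\big[gcdn/0]_(i < k) `|v 0%R i|)%N.

Lemma dvdn_vgcd {k : nat} {v : 'rV[int]_k} {d : nat} :
  reflect (forall i, (d %| `|v 0%R i|)%N) (d %| vgcd v)%N.
Proof.
apply: (iffP idP) => [/dvdn_biggcdP h i|h]; first exact: h.
by apply/dvdn_biggcdP => i _; exact: h.
Qed.

Lemma vgcd_scale {k : nat} (v : 'rV[int]_k) (d : nat) :
  vgcd (d%:Z *: v) = (d * vgcd v)%N.
Proof.
rewrite /vgcd (big_morph _ (@muln_gcdr d) (muln0 d)).
by apply: eq_bigr => i _; rewrite mxE abszM.
Qed.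

Lemma vgcd0 {k : nat} (v : 'rV[int]_k) : (vgcd v == 0)%N = (v == 0).
Proof.
rewrite -dvd0n; apply/dvdn_vgcd/eqP => [h|-> i]; last by rewrite mxE.
by apply/rowP => i; have := h i; rewrite dvd0n absz_eq0 mxE => /eqP.
Qed.

(** Bezout for two integers merges the combinations of two partial gcds. A single entry takes its
    sign as coefficient, since [vgcd] uses absolute values. *)
Lemma Bezout_row {k : nat} (v : 'rV[int]_k) :
  exists u : 'I_k -> int, \sum_i u i * v 0 i = (vgcd v)%:Z.
Proof.
rewrite /vgcd; apply: (big_ind (fun g : nat => exists u : 'I_k -> int, \sum_i u i * v 0 i = g%:Z)).
- by exists (fun=> 0); rewrite big1 // => i _; rewrite mul0r.
- move=> x y [ux hx] [uy hy]; have [a [b hab]] := Bezoutz x%:Z y%:Z.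
  exists (fun i => a * ux i + b * uy i).
  have -> : (gcdn x y)%:Z = gcdz x y by [].
  rewrite -hab -hx -hy !mulr_sumr -big_split /=.
  by apply: eq_bigr => i _; rewrite mulrDl !mulrA.
- move=> i _; exists (fun j => if j == i then Num.sg (v 0 i) else 0).
  rewrite (bigD1 i) //= eqxx big1 ?addr0.
    by rewrite -normrEsg abszE.
  by move=> j /negbTE ->; rewrite mul0r.
Qed.

(** * Satisfiability as a divisibility of gcds *)

Definition sat_equations (k m : nat) : set (equations k m) :=
  [set w | (vgcd w.1 %| vgcd w.2)%N].

Lemma eqn_lhs_combination {A : zmodType} {k m : nat} (a : 'I_m -> A)
    (H : 'I_k -> 'I_m -> int) (c : 'rV[int]_k) (d : 'rV[int]_m) :
  (\sum_i (\sum_j a j *~ H i j) *~ c 0 i) + (\sum_j a j *~ d 0 j) =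
  \sum_j a j *~ (\sum_i c 0 i * H i j + d 0 j).
Proof.
under [RHS]eq_bigr do rewrite mulrzDr mulrz_sumr.
rewrite big_split /= exchange_big /=; congr (_ + _); apply: eq_bigr => i _.
by rewrite mulrz_suml; apply: eq_bigr => j _; rewrite mulrC mulrzA.
Qed.

(** In coordinates the equation splits into one linear equation over the integers for each basis
    element, all with the coefficients [c]. *)
Lemma SAT_basisE (A : zmodType) (k m : nat) (a : 'I_m -> A) :
  is_basis a -> SAT k a = sat_equations k m.
Proof.
move=> ha; apply/seteqP; split => -[c d]; rewrite /SAT /sat_equations /=.
  move=> [h hcd].
  have /choice[H hH] : forall i, exists e : 'rV[int]_m, h i = \sum_j a j *~ e 0 j.
    by move=> i; have [e [he _]] := ha (h i); exists e.
  pose e : 'rV[int]_m := \row_j (\sum_i c 0 i * H i 0 j + d 0 j).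
  have he : 0 = \sum_j a j *~ e 0 j.
    under eq_bigr do rewrite mxE; rewrite -(eqn_lhs_combination _ (fun i j => H i 0 j)).
    by rewrite -[LHS]hcd; congr (_ + _); apply: eq_bigr => i _; rewrite hH.
  (* Uniqueness of the coordinates of 0 makes every coordinate of the left-hand side vanish. *)
  have [z [_ zU]] := ha 0.
  have e0 : e = 0.
    rewrite -(zU e he); apply: zU.
    by rewrite big1 // => j _; rewrite mxE mulr0z.
  apply/dvdn_vgcd => j.
  have -> : d 0 j = - \sum_i c 0 i * H i 0 j.
    by apply/eqP; rewrite -addr_eq0 addrC; move/rowP: e0 => /(_ j); rewrite !mxE => ->.
  rewrite abszN; apply: (@big_ind int (fun x => vgcd c %| `|x|)%N) => //.
  - by move=> x y; rewrite -!(dvdzE (vgcd c)%:Z); exact: rpredD.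
  - by move=> i _; rewrite abszM dvdn_mulr //; move: i; apply/dvdn_vgcd.
move=> /dvdn_vgcd hd; have [u hu] := Bezout_row c.
(* The Bezout combination of [c], rescaled to reach [- d 0 j]. If the gcd is 0, then so is [d 0 j],
   and the quotient by 0 is harmless. *)
exists (fun i => \sum_j a j *~ (- (u i * divz (d 0 j) (vgcd c)%:Z))).
rewrite eqn_lhs_combination big1 // => j _.
have -> : \sum_i c 0 i * - (u i * divz (d 0 j) (vgcd c)%:Z) = - d 0 j.
  rewrite -[in RHS](@divzK (vgcd c)%:Z (d 0 j)); last by rewrite dvdzE; exact: hd.
  rewrite [X in _ = - X]mulrC -[in RHS]hu mulr_suml -sumrN; apply: eq_bigr => i _.
  by rewrite hu mulrN mulrA (mulrC (c 0 i)).
by rewrite addNr mulr0z.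
Qed.

(** * Counting vectors and equations by gcd *)

Lemma scale_inj (k d : nat) : (0 < d)%N -> injective (fun v : 'rV[int]_k => d%:Z *: v).
Proof.
move=> d0 v w /rowP vw; apply/rowP => i; have := vw i; rewrite !mxE.
by apply: mulfI; lia.
Qed.

Lemma box_scale {k r d : nat} (v : 'rV[int]_k) : (0 < d)%N ->
  box k r (d%:Z *: v) <-> box k (r %/ d) v.
Proof.
by move=> d0; split=> h i; have := h i; rewrite mxE abszM leq_divRL // mulnC.
Qed.

Lemma dvdn_vgcdP {k d : nat} (v : 'rV[int]_k) :
  (d %| vgcd v)%N -> exists w, v = d%:Z *: w.
Proof.
move=> /dvdn_vgcd dv; exists (\row_i divz (v 0 i) d%:Z).
by apply/rowP => i; rewrite !mxE mulrC divzK // dvdzE; exact: dv.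
Qed.

Definition num_primitive (k r : nat) : nat :=
  #|` fset_set (box k r `&` [set v | vgcd v = 1%N])|.

(** Multiplication by [d] is a bijection from the primitive vectors of the box of radius
    [r %/ d]. *)
Lemma card_vgcd_eq (k r d : nat) : (0 < d)%N ->
  #|` fset_set (box k r `&` [set v | vgcd v = d])| = num_primitive k (r %/ d).
Proof.
move=> d0; rewrite /num_primitive -[RHS](card_image_inj (@scale_inj k d d0)); last first.
  by apply: finite_setIl; exact: finite_box.
congr (#|` fset_set _|); apply/seteqP; split => [v [vr /= vd]|_ [w [wr /= w1] <-]].
  have [w vE] : exists w, v = d%:Z *: w by apply: dvdn_vgcdP; rewrite vd.
  exists w; last by [].
  rewrite vE in vr vd; split; first exact/(box_scale _ d0).
  by move: vd; rewrite vgcd_scale /= -[RHS]muln1 => /eqP; rewrite eqn_pmul2l // => /eqP.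
by split; [exact/(box_scale _ d0) | rewrite /= vgcd_scale w1 muln1].
Qed.

Lemma card_dvd_vgcd (m r d : nat) : (0 < d)%N ->
  #|` fset_set (box m r `&` [set v | (d %| vgcd v)%N])| = ((r %/ d).*2.+1 ^ m)%N.
Proof.
move=> d0; rewrite -card_box -[RHS](card_image_inj (@scale_inj m d d0)); last exact: finite_box.
congr (#|` fset_set _|); apply/seteqP; split => [v [vr /= /dvdn_vgcdP[w vE]]|_ [w wr <-]].
  by exists w => //; rewrite vE in vr; exact/(box_scale _ d0).
by split; [exact/(box_scale _ d0) | rewrite /= vgcd_scale dvdn_mulr].
Qed.

(** The classes [F d] of a given gcd are disjoint products. The summand 1 is the class of gcd 0,
    which holds only the zero equation. *)
Lemma card_sat_equations (k m r : nat) : (0 < k)%N ->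
  #|` fset_set (sat_equations k m `&` eqn_ball k m r)| =
  (1 + \sum_(0 <= d < r) num_primitive k (r %/ d.+1) * (r %/ d.+1).*2.+1 ^ m)%N.
Proof.
move=> k0.
pose F d := (box k r `&` [set v | vgcd v = d]) `*` (box m r `&` [set v | (d %| vgcd v)%N]).
have finF1 d : finite_set (box k r `&` [set v | vgcd v = d]).
  by apply: finite_setIl; exact: finite_box.
have finF2 d : finite_set (box m r `&` [set v | (d %| vgcd v)%N]).
  by apply: finite_setIl; exact: finite_box.
have finF d : finite_set (F d) by exact: finite_setX.
have trivF : trivIset setT F.
  by move=> i j _ _ [[c d] [[[_ /= <-] _] [[_ /= <-] _]]].
have -> : sat_equations k m `&` eqn_ball k m r = \big[setU/set0]_(d < r.+1) F d.
  rewrite -bigcup_mkord eqn_ballE; apply/seteqP; split => [[c d] /= [cd [cr dr]]|[c d]].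
    exists (vgcd c) => //=; rewrite ltnS.
    have [/eqP c0|] := posnP (vgcd c); first by rewrite (eqP c0).
    (* A nonzero gcd divides some nonzero entry, hence is at most [r]. *)
    move=> c0; have [i ci] : exists i, c 0 i != 0.
      apply/existsP; rewrite -negb_forall; apply/negP => /forallP h.
      move: c0; rewrite lt0n vgcd0 => /eqP; apply.
      by apply/rowP => i; rewrite mxE; exact/eqP.
    apply: leq_trans (cr i); apply: dvdn_leq; first by rewrite absz_gt0.
    exact/dvdn_vgcd.
  by move=> [g _ [[cr /= <-] [dr ?]]].
rewrite -trivIset_sum_card // big_ord_recl /= card_setX // ; congr (_ + _)%N.
  have one (n : nat) : box n r `&` [set v | (0 %| vgcd v)%N] = [set 0].
    apply/seteqP; split => [v [_ /=]|_ ->]; first by rewrite dvd0n vgcd0 => /eqP.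
    by split => [i|]; rewrite /= ?mxE // dvd0n vgcd0.
  rewrite (_ : box k r `&` _ = box k r `&` [set v | (0 %| vgcd v)%N]).
    by rewrite !one !fset_set1 !cardfs1.
  by congr (_ `&` _); apply/funext => v; rewrite /= dvd0n; apply/propext; split => /eqP.
rewrite big_mkord; apply: eq_bigr => d _.
by rewrite card_setX // card_vgcd_eq // card_dvd_vgcd.
Qed.

Lemma card_eqn_ball (k m r : nat) : #|` fset_set (eqn_ball k m r)| = (r.*2.+1 ^ (k + m))%N.
Proof. by rewrite eqn_ballE card_setX ?card_box ?expnD //; exact: finite_box. Qed.

Lemma sum_num_primitive (k r : nat) : (0 < k)%N ->
  (r.*2.+1 ^ k = 1 + \sum_(0 <= d < r) num_primitive k (r %/ d.+1))%N.
Proof.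
move=> k0; have := @card_sat_equations k 0 r k0.
(* The gcd of the empty row is 0, which everything divides. *)
rewrite (_ : sat_equations k 0 = setT) ?setTI; last first.
  by apply/seteqP; split => // -[c d] _; rewrite /sat_equations /= /vgcd big_ord0.
rewrite card_eqn_ball addn0 => ->; congr (1 + _)%N.
by apply: eq_bigr => d _; rewrite muln1.
Qed.

(** * Density of primitive vectors and of satisfiable equations *)

Definition primitive_ratio (R : realType) (k n : nat) : R :=
  (num_primitive k n)%:R / n.*2.+1%:R ^+ k.

Lemma primitive_ratio_bound (R : realType) (k n : nat) : `|primitive_ratio R k n| <= 1.
Proof.
rewrite ger0_norm ?divr_ge0 ?exprn_ge0 // ler_pdivrMr ?exprn_gt0 // mul1r -natrX ler_nat.
rewrite -card_box; apply: fsubset_leq_card; have fin := finite_box k n.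
by rewrite -fset_set_sub //; exact: finite_setIl.
Qed.

(** Each term is multiplied and divided by the [k]-th power of the side of its smaller box. *)
Lemma dilation_sumE (R : realType) (k m r : nat) :
  (\sum_(0 <= d < r) num_primitive k (r %/ d.+1) * (r %/ d.+1).*2.+1 ^ m)%:R
    / r.*2.+1%:R ^+ (k + m) =
  \sum_(0 <= d < r) primitive_ratio R k (r %/ d.+1) * side_ratio R r d ^+ (k + m) :> R.
Proof.
rewrite natr_sum mulr_suml; apply: eq_bigr => d _.
rewrite /primitive_ratio /side_ratio expr_div_n natrM natrX !exprD.
have nz (n i : nat) : n.*2.+1%:R ^+ i != 0 :> R by rewrite expf_neq0 // pnatr_eq0.
by field; rewrite !nz.
Qed.

Lemma inv_side_cvg0 (R : realType) (k : nat) : (0 < k)%N ->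
  1 / n.*2.+1%:R ^+ k @[n --> \oo] --> (0 : R).
Proof.
move=> k0; apply: (@squeeze_cvgr _ _ _ _ (cst 0) harmonic); last exact: cvg_harmonic.
  apply: nearW => n; rewrite /= divr_ge0 ?exprn_ge0 //= mul1r.
  rewrite lef_pV2 ?posrE ?exprn_gt0 // -natrX ler_nat.
  case: k k0 => // k _; rewrite expnS.
  by have := expn_gt0 n.*2.+1 k; rewrite /=; nia.
exact: cvg_cst.
Qed.

Lemma primitive_ratio_cvg (R : realType) (k : nat) : (1 < k)%N ->
  primitive_ratio R k @ \oo --> (zeta (k%:R : R))^-1.
Proof.
move=> k1; have k0 : (0 < k)%N by exact: ltnW.
have z0 : zeta (k%:R : R) != 0 by rewrite gt_eqF // (lt_le_trans ltr01) // zeta_ge1.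
set z := zeta _ in z0 *.
pose x n := primitive_ratio R k n - z^-1.
(* The sum for the primitive ratio is exact by [sum_num_primitive]; that for the constant 1 / zeta k
   tends to 1. The two limits cancel. *)
have sumE n : \sum_(0 <= d < n) x (n %/ d.+1)%N * side_ratio R n d ^+ k =
    1 - 1 / n.*2.+1%:R ^+ k - \sum_(0 <= d < n) z^-1 * side_ratio R n d ^+ k.
  under eq_bigr do rewrite mulrBl.
  rewrite sumrB; congr (_ - _); have := @dilation_sumE R k 0 n; rewrite addn0 => <-.
  under eq_bigr do rewrite expn0 muln1.
  have sn : n.*2.+1%:R ^+ k != 0 :> R by rewrite expf_neq0 // pnatr_eq0.
  rewrite -[X in X - _](divff sn) -mulrBl; congr (_ / _).
  by rewrite -natrX (sum_num_primitive k n k0) natrD addrC addKr.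
have x0 : x @ \oo --> 0.
  apply: (@dilation_sum_cvg0 _ k _ (1 + `|z^-1|)) => // [n|].
    by apply: le_trans (ler_normB _ _) _; rewrite lerD2r primitive_ratio_bound.
  have lim : 1 - 1 / n.*2.+1%:R ^+ k - \sum_(0 <= d < n) z^-1 * side_ratio R n d ^+ k
      @[n --> \oo] --> 1 - 0 - z^-1 * z.
    apply: cvgB; first by apply: cvgB; [exact: cvg_cst | exact: inv_side_cvg0].
    by apply: (@dilation_sum_cvg _ _ (cst z^-1) _ `|z^-1|) => //; exact: cvg_cst.
  by move: lim; rewrite mulVf // subr0 subrr; under eq_fun do rewrite -sumE.
have -> : primitive_ratio R k = x \+ cst z^-1 by apply/funext => n; rewrite /x /= subrK.
by rewrite -[z^-1]add0r; apply: cvgD => //; rewrite add0r; exact: cvg_cst.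
Qed.

Theorem theorem2p8 (R : realType) (m k : nat) (hm : (1 <= m)%N) (hk : (2 <= k)%N)
    (A : zmodType) (a : 'I_m -> A) (ha : is_basis a) :
  cvgn (rho_ R (SAT k a)) /\
  rho R (SAT k a) = zeta ((k + m)%:R : R) / zeta (k%:R : R).
Proof.
have k0 : (0 < k)%N by exact: ltnW.
suff h : rho_ R (SAT k a) @ \oo --> zeta ((k + m)%:R : R) / zeta (k%:R : R).
  by split; [exact: cvgP h | exact: cvg_lim h].
(* The first summand is the share of the zero equation, negligible in the limit. *)
have -> : rho_ R (SAT k a) = fun r => 1 / r.*2.+1%:R ^+ (k + m) +
    \sum_(0 <= d < r) primitive_ratio R k (r %/ d.+1) * side_ratio R r d ^+ (k + m).
  apply/funext => r; rewrite /rho_ (SAT_basisE _ _ _ _ ha) card_sat_equations // card_eqn_ball.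
  by rewrite natrD mulrDl natrX dilation_sumE.
rewrite -[zeta _ / _]add0r; apply: cvgD.
  by apply: inv_side_cvg0; rewrite addn_gt0 k0.
rewrite mulrC; apply: (@dilation_sum_cvg _ _ _ _ 1).
- by rewrite (leq_trans hk) // leq_addr.
- exact: primitive_ratio_cvg.
- by move=> n; exact: primitive_ratio_bound.
Qed.
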